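(* Let $0<\alpha\le1$, $m\in(0,1]$, let $I\subseteq\mathbb{R}$ with $(0,1)\subseteq I$, and let $h:I\to\mathbb{R}$ be non-negative (and integrable on $(0,1)$). Let $J\subseteq[0,\infty)$ be an interval with left endpoint $0\in J$ and let $\mathcal{G}:J\to\mathbb{R}$ be generalized $(h-m)$-convex. If $0\le\nu<\mu<\infty$ with $\nu,\mu\in J$ (and $m\mu\neq\nu$) and $\mathcal{G}\in L_{1}[m\nu,\mu]$, then $$\frac{1}{m^{\alpha}+1}\left[\frac{1}{m\mu-\nu}\int_{\nu}^{m\mu}\mathcal{G}(x)\,dx+\frac{1}{\mu-m\nu}\int_{m\nu}^{\mu}\mathcal{G}(x)\,dx\right]\le\bigl(\mathcal{G}(\nu)+\mathcal{G}(\mu)\bigr)\left[\int_{0}^{1}h(\gamma)\,d\gamma+\int_{0}^{1}h(1-\gamma)\,d\gamma\right].$$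
   Context: All integrals here are ordinary (Lebesgue) integrals of real-valued functions. Here $\mathcal{G}:J\to\mathbb{R}$ is called generalized $(h-m)$-convex if $\mathcal{G}$ is positive (in the sense $\mathcal{G}\ge0$) and $$\mathcal{G}(\gamma\nu+m(1-\gamma)\mu)\le h(\gamma)\mathcal{G}(\nu)+m^{\alpha}h(1-\gamma)\mathcal{G}(\mu)$$ for all $\nu,\mu\in J$ and all $\gamma\in(0,1)$. *)

(* Defs.v *)
From mathcomp Require Import all_boot all_order all_algebra.
From mathcomp Require Import all_classical all_reals all_analysis.
Import Order.TTheory GRing.Theory Num.Theory.
Import numFieldNormedType.Exports.

Set Implicit Arguments.
Unset Strict Implicit.
Unset Printing Implicit Defensive.

Local Open Scope classical_set_scope.
Local Open Scope ring_scope.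

(* Real functions defined on a subset of R are represented by total functions;
   only their values on that subset are constrained or used. *)

(* Membership in J of the argument on the left is not required here: it is
   automatic when J is an interval containing 0 and 0 < m <= 1. *)
Definition generalized_hm_convex (R : realType) (alpha m : R) (h : R -> R)
    (J : set R) (G : R -> R) : Prop :=
  (forall x, J x -> 0 <= G x) /\
  (forall nu mu g, J nu -> J mu -> 0 < g < 1 ->
     G (g * nu + m * (1 - g) * mu)
       <= h g * G nu + (m `^ alpha) * h (1 - g) * G mu).

(* The bounds may come in either order:
   oriented_integral b a f = - oriented_integral a b f. *)
Definition oriented_integral (R : realType) (a b : R) (f : R -> R) : R :=
  if a <= b then \int[@lebesgue_measure R]_(x in `[a, b]) f x
  else - \int[@lebesgue_measure R]_(x in `[b, a]) f x.

(* Main.v *)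
Require Import Defs.
From mathcomp Require Import all_boot all_order all_algebra.
From mathcomp Require Import all_classical all_reals all_analysis.
From mathcomp Require Import measurable_realfun ring lra.
Import Order.TTheory GRing.Theory Num.Theory.
Import numFieldNormedType.Exports.
Local Open Scope classical_set_scope.
Local Open Scope ring_scope.

(** Both normalised integrals are means of [G] along a segment, parametrised
    by [t] in [(0, 1)]: the affine change of variables turns
    [(q - p)^-1 * (integral of G from p to q)] into the integral over [(0, 1)]
    of [G (p + (q - p) * t)], whichever of [p] and [q] is larger
    ([oriented_mean_segment]).

    On the segment from [nu] to [m * mu] the argument of [G] is
    [(1 - t) * nu + m * t * mu], and on the segment from [m * nu] to [mu] it is
    [t * mu + m * (1 - t) * nu].  Convexity bounds the two values by
    [h (1 - t) * G nu + m `^ alpha * h t * G mu] and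
    [h t * G mu + m `^ alpha * h (1 - t) * G nu].  The two bounds add up to
    [(m `^ alpha + 1) * (h (1 - t) * G nu + h t * G mu)].  Integrating over
    [(0, 1)] and dividing by [m `^ alpha + 1] bounds the left-hand side by
    [H' * G nu + H * G mu], where [H] and [H'] are the integrals of [h t] and
    [h (1 - t)]; as everything is non-negative this is at most
    [(G nu + G mu) * (H + H')].

    The analytic input is the affine change of variables for merely integrable
    functions, since [G] and [h] need not be continuous.  It comes from the
    uniqueness of Lebesgue measure: the image of Lebesgue measure under
    [t |-> c + d * t], multiplied by [`|d|], gives every interval its length
    ([lebesgue_measure_affine]).  This also gives the integrability of
    [h (1 - t)], the composite of [h] with the segment from 1 to 0. *)

(** * The affine change of variables *)

Lemma affine_preimage_itv_pos {R : realType} (c d : R) (b1 b2 : bool) (x y : R) :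
  0 < d ->
  (fun t => c + d * t) @^-1` [set` Interval (BSide b1 x) (BSide b2 y)]
  = [set` Interval (BSide b1 ((x - c) / d)) (BSide b2 ((y - c) / d))].
Proof.
move=> d0; apply/seteqP; split=> t /=; rewrite !in_itv/=;
  by case: b1; case: b2; rewrite /= ?ler_pdivrMr ?ler_pdivlMr ?ltr_pdivrMr
    ?ltr_pdivlMr // ?lerBlDl ?lerBrDl ?ltrBlDl ?ltrBrDl [t * d]mulrC.
Qed.

(** A decreasing map exchanges the two ends, so a bound that was included
    on the left becomes included on the right: hence the negated flags. *)
Lemma affine_preimage_itv_neg {R : realType} (c d : R) (b1 b2 : bool) (x y : R) :
  d < 0 ->
  (fun t => c + d * t) @^-1` [set` Interval (BSide b1 x) (BSide b2 y)]
  = [set` Interval (BSide (~~ b2) ((y - c) / d)) (BSide (~~ b1) ((x - c) / d))].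
Proof.
move=> d0; apply/seteqP; split=> t /=; rewrite !in_itv/= andbC;
  by case: b1; case: b2; rewrite /= ?ler_ndivrMr ?ler_ndivlMr ?ltr_ndivrMr
    ?ltr_ndivlMr // ?lerBlDl ?lerBrDl ?ltrBlDl ?ltrBrDl [t * d]mulrC.
Qed.

Lemma measurable_affine {R : realType} (c d : R) :
  measurable_fun [set: R] (fun t : R => c + d * t).
Proof. by apply: measurable_funD => //; exact: measurable_funM. Qed.

Lemma measurable_affine_preimage {R : realType} (c d : R) (D : set R) :
  measurable D -> measurable ((fun t => c + d * t) @^-1` D).
Proof. by move=> mD; rewrite -[_ @^-1` _]setTI; exact: measurable_affine. Qed.

(** The measure structure of a push-forward depends on a proof that the map is
    measurable; naming the measure fixes that proof once. *)
Definition affine_pushforward {R : realType} (c d : R) :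
    {measure set (measurableTypeR R) -> \bar R} :=
  measure_function_pushforward__canonical__measure_function_Measure
    (@lebesgue_measure R)
    (measurable_affine c d : measurable_fun [set: measurableTypeR R]
       (fun t => c + d * t : measurableTypeR R)).

(** It is enough to compare the two measures on half-open intervals, where the
    factor [`|d|] cancels the change of length. *)
Lemma lebesgue_measure_affine {R : realType} (c d : R) (A : set R) :
  d != 0 -> measurable A ->
  @lebesgue_measure R A = mscale (NngNum (normr_ge0 d)) (affine_pushforward c d) A.
Proof.
move=> d0 mA.
apply: (@lebesgue_measure_unique R
          (mscale (NngNum (normr_ge0 d)) (affine_pushforward c d))) => // _ [[x y] _ <-].
rewrite /= /mscale/= /pushforward.
have [dn|dp|] := ltgtP d 0; last by move/eqP; rewrite (negPf d0).
- rewrite affine_preimage_itv_neg// !lebesgue_measure_itv/= !lte_fin.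
  rewrite ltr_nM2r ?invr_lt0// ltrD2r; case: ifPn => _; last by rewrite mule0.
  rewrite ltr0_norm// -EFinD -EFinM; congr EFin; by field.
- rewrite affine_preimage_itv_pos// !lebesgue_measure_itv/= !lte_fin.
  rewrite ltr_pM2r ?invr_gt0// ltrD2r; case: ifPn => _; last by rewrite mule0.
  rewrite gtr0_norm// -EFinD -EFinM; congr EFin; by field.
Qed.

Lemma ge0_integral_affine {R : realType} (c d : R) (D : set R) (f : R -> \bar R) :
  d != 0 -> measurable D -> measurable_fun D f ->
  (forall x, D x -> (0 <= f x)%E) ->
  (\int[@lebesgue_measure R]_(x in D) f x
   = `|d|%:E * \int[@lebesgue_measure R]_(t in (fun t => c + d * t)%R @^-1` D)
                 f (c + d * t)%R)%E.
Proof.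
move=> d0 mD mf f0.
rewrite (eq_measure_integral
           (mscale (NngNum (normr_ge0 d)) (affine_pushforward c d))); last first.
  by move=> A mA _; exact: lebesgue_measure_affine.
rewrite ge0_integral_mscale//= ge0_integral_pushforward//.
  exact: measurable_affine.
by move=> x /set_mem; exact: f0.
Qed.

Lemma integrable_affine {R : realType} (c d : R) (D : set R) (f : R -> R) :
  d != 0 -> measurable D ->
  (@lebesgue_measure R).-integrable D (EFin \o f) ->
  (@lebesgue_measure R).-integrable ((fun t => c + d * t) @^-1` D)
    (EFin \o (fun t => f (c + d * t))).
Proof.
move=> d0 mD /integrableP[mf fi]; apply/integrableP; split.
  apply: (measurable_comp mD _ mf); first by move=> _ [t Dt <-].
  exact: measurable_funS (measurable_affine c d).
move: fi; rewrite (ge0_integral_affine c d)//; last exact: measurableT_comp.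
move=> fi; rewrite ltey; apply/eqP => fy; move: fi => /=.
by rewrite fy gt0_muley ?ltxx// lte_fin normr_gt0.
Qed.

(** Reduces to the non-negative case through positive and negative parts;
    integrability is what allows their integrals to be subtracted. *)
Lemma Rintegral_affine {R : realType} (c d : R) (D : set R) (f : R -> R) :
  d != 0 -> measurable D ->
  (@lebesgue_measure R).-integrable D (EFin \o f) ->
  \int[@lebesgue_measure R]_(x in D) f x
  = `|d| * \int[@lebesgue_measure R]_(t in (fun t => c + d * t) @^-1` D)
             f (c + d * t).
Proof.
move=> d0 mD fi.
have mf := measurable_int _ fi.
have gi := integrable_affine c d D f d0 mD fi.
rewrite /Rintegral integralE [X in _ = _ * fine X]integralE.
rewrite (ge0_integral_affine c d _ ((EFin \o f)^\+)%E)//; last first.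
  exact: measurable_funepos.
rewrite (ge0_integral_affine c d _ ((EFin \o f)^\-)%E)//; last first.
  exact: measurable_funeneg.
under [in LHS]eq_integral do rewrite funeposE.
under [X in (_ - _ * X)%E]eq_integral do rewrite funenegE.
under [X in _ = _ * fine (X - _)%E]eq_integral do rewrite funeposE.
under [X in _ = _ * fine (_ - X)%E]eq_integral do rewrite funenegE.
have mD' := measurable_affine_preimage c d D mD.
have /(_ mD') := integrable_pos_fin_num _ gi.
under eq_integral do rewrite funeposE.
have /(_ mD') := integrable_neg_fin_num _ gi.
under eq_integral do rewrite funenegE.
move=> nf pf; rewrite -[RHS]/(fine (`|d|%:E) * _) -fineM//; last first.
  by rewrite fin_numB pf nf.
by rewrite [X in _ = fine X]muleBr// fin_num_adde_defl// fin_numN.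
Qed.

(** * Means along a segment *)

Lemma segment_preimage {R : realType} (p q : R) : p != q ->
  (fun t => p + (q - p) * t) @^-1` `]Num.min p q, Num.max p q[ = `]0, 1[%classic.
Proof.
move=> pq; have [lt_pq|lt_qp|] := ltgtP p q; last by move/eqP; rewrite (negPf pq).
- rewrite affine_preimage_itv_pos ?subr_gt0// subrr mul0r divff//.
  by rewrite subr_eq0 eq_sym.
- rewrite affine_preimage_itv_neg ?subr_lt0// subrr mul0r divff//.
  by rewrite subr_eq0 eq_sym.
Qed.

Lemma integrable_segment {R : realType} (p q : R) (f : R -> R) : p != q ->
  (@lebesgue_measure R).-integrable `]Num.min p q, Num.max p q[ (EFin \o f) ->
  (@lebesgue_measure R).-integrable `]0, 1[
    (EFin \o (fun t => f (p + (q - p) * t))).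
Proof.
move=> pq fi; rewrite -(segment_preimage p q)//; apply: integrable_affine => //.
by rewrite subr_eq0 eq_sym.
Qed.

(** The sign of [q - p] chosen by the orientation of the integral is the one
    that turns the Jacobian [`|q - p|] back into [q - p], so the same formula
    holds for both orders of the end points. *)
Lemma oriented_mean_segment {R : realType} (p q : R) (f : R -> R) : p != q ->
  (@lebesgue_measure R).-integrable `[Num.min p q, Num.max p q] (EFin \o f) ->
  (q - p)^-1 * oriented_integral p q f
  = \int[@lebesgue_measure R]_(t in `]0, 1[) f (p + (q - p) * t).
Proof.
move=> pq fi; have qp0 : q - p != 0 by rewrite subr_eq0 eq_sym.
have -> : oriented_integral p q f = Num.sg (q - p) *
    \int[@lebesgue_measure R]_(x in `]Num.min p q, Num.max p q[) f x.
  rewrite Rintegral_itv_bndo_bndc; last first.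
    by apply: integrableS fi => //; exact: subset_itv_oo_cc.
  rewrite Rintegral_itv_obnd_cbnd; last first.
    by apply: integrableS fi => //; exact: subset_itv_oc_cc.
  rewrite /oriented_integral.
  have [lt_pq|lt_qp|] := ltgtP p q; last by move/eqP; rewrite (negPf pq).
  - by rewrite gtr0_sg ?subr_gt0// mul1r.
  - by rewrite ltr0_sg ?subr_lt0// mulN1r.
rewrite (Rintegral_affine p (q - p))//; last first.
  by apply: integrableS fi => //; exact: subset_itv_oo_cc.
by rewrite segment_preimage// !mulrA -(mulrA _ (Num.sg _)) -numEsg mulVf// mul1r.
Qed.

(** * The inequality *)

Theorem theorem8 (R : realType) (alpha m : R)
    (I : set R) (h : R -> R) (J : set R) (G : R -> R) (nu mu : R)
    (halpha : 0 < alpha <= 1) (hm : 0 < m <= 1)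
    (hI : `]0, 1[ `<=` I)
    (h_ge0 : forall x, I x -> 0 <= h x)
    (h_int : (@lebesgue_measure R).-integrable `]0, 1[ (EFin \o h))
    (J_sub : J `<=` `[0, +oo[) (J_itv : is_interval J) (J0 : J 0)
    (G_convex : generalized_hm_convex alpha m h J G)
    (nu_ge0 : 0 <= nu) (nu_lt_mu : nu < mu) (J_nu : J nu) (J_mu : J mu)
    (m_mu_neq_nu : m * mu <> nu)
    (G_int : (@lebesgue_measure R).-integrable `[m * nu, mu] (EFin \o G)) :
  (m `^ alpha + 1)^-1 *
    ((m * mu - nu)^-1 * oriented_integral nu (m * mu) G
     + (mu - m * nu)^-1 * oriented_integral (m * nu) mu G)
  <= (G nu + G mu) *
     (\int[@lebesgue_measure R]_(x in `]0, 1[) h x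
      + \int[@lebesgue_measure R]_(x in `]0, 1[) h (1 - x)).
Proof.
case/andP: hm => m_gt0 m_le1; case: G_convex => G_ge0 G_conv.
set mu1 := m * mu; set nu1 := m * nu.
have nu1_le_nu : nu1 <= nu by rewrite ler_piMl.
have mu1_le_mu : mu1 <= mu by rewrite ler_piMl// (le_trans nu_ge0) ?ltW.
have nu1_lt_mu1 : nu1 < mu1 by rewrite ltr_pM2l.
have nu1_lt_mu : nu1 < mu by exact: lt_le_trans mu1_le_mu.
have nu_neq_mu1 : nu != mu1 by apply/eqP => e; exact: m_mu_neq_nu.
have nu1_neq_mu : nu1 != mu by rewrite lt_eqF.
(* Both segments lie inside the interval on which G is integrable. *)
have Gi1 : (@lebesgue_measure R).-integrable
    `[Num.min nu mu1, Num.max nu mu1] (EFin \o G).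
  apply: integrableS G_int => // x /=; rewrite !in_itv/= ge_min le_max.
  move=> /andP[/orP[] xl /orP[] xr]; apply/andP; split;
    by first [exact: (le_trans _ xl) | exact: (le_trans (ltW _) xl)
             | exact: (le_trans xr) | exact: (le_trans xr (ltW _))].
have Gi2 : (@lebesgue_measure R).-integrable
    `[Num.min nu1 mu, Num.max nu1 mu] (EFin \o G).
  by rewrite (min_l (ltW nu1_lt_mu)) (max_r (ltW nu1_lt_mu)).
rewrite !oriented_mean_segment//.
have integrable_along p q : p != q ->
    (@lebesgue_measure R).-integrable `[Num.min p q, Num.max p q] (EFin \o G) ->
    (@lebesgue_measure R).-integrable `]0, 1[
      (EFin \o (fun t => G (p + (q - p) * t))).
  move=> pq Gi; apply: integrable_segment => //.
  by apply: integrableS Gi => //; exact: subset_itv_oo_cc.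
have Gp1 := integrable_along _ _ nu_neq_mu1 Gi1.
have Gp2 := integrable_along _ _ nu1_neq_mu Gi2.
have h'_int : (@lebesgue_measure R).-integrable `]0, 1[
    (EFin \o (fun t => h (1 - t))).
  have := @integrable_segment R 1 0 h (oner_neq0 _).
  rewrite min_r// max_l// => /(_ h_int); apply: eq_integrable => // t _ /=.
  by congr (h _)%:E; ring.
set H := (X in _ <= _ * (X + _)); set H' := (X in _ <= _ * (_ + X)).
have Ga := G_ge0 _ J_nu; have Gb := G_ge0 _ J_mu.
have ma_ge0 : 0 <= m `^ alpha by exact: powR_ge0.
have H_ge0 : 0 <= H by apply: Rintegral_ge0 => x /hI; exact: h_ge0.
have H'_ge0 : 0 <= H'.
  apply: Rintegral_ge0 => x; rewrite /= in_itv/= => /andP[x0 x1].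
  by apply/h_ge0/hI; rewrite /= in_itv/=; lra.
have intZ c f : (@lebesgue_measure R).-integrable `]0, 1[ (EFin \o f) ->
    (@lebesgue_measure R).-integrable `]0, 1[ (EFin \o (fun t => c * f t)).
  by move=> fi; apply: (integrableZl _ _ fi).
have intD f g : (@lebesgue_measure R).-integrable `]0, 1[ (EFin \o f) ->
    (@lebesgue_measure R).-integrable `]0, 1[ (EFin \o g) ->
    (@lebesgue_measure R).-integrable `]0, 1[ (EFin \o (fun t => f t + g t)).
  by move=> fi gi; apply: (integrableD _ fi gi).
rewrite -RintegralD//.
(* Convexity bounds the left-hand side by the middle term; what remains is to add the non-negative
   cross terms G nu * H and G mu * H'. *)
apply: (@le_trans _ _ ((m `^ alpha + 1)^-1 *
    ((m `^ alpha + 1) * (G nu * H' + G mu * H)))); last first.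
  by rewrite mulKf ?lt0r_neq0 ?ltr_wpDl//; nra.
rewrite ler_wpM2l ?invr_ge0 ?addr_ge0//.
rewrite -!RintegralZl// -RintegralD//; [|exact: intZ..].
rewrite -RintegralZl//; last by apply: (intD); exact: (intZ).
apply: le_Rintegral => //.
- exact: intD.
- by apply: (intZ); apply: (intD); exact: (intZ).
move=> t; rewrite /= in_itv/= => /andP[t0 t1].
(* Convexity is used at (mu, nu) with weight t, and at (nu, mu) with weight
   1 - t, so that the arguments of G match the two parametrisations. *)
have t01 : 0 < t < 1 by rewrite t0.
have t'01 : 0 < 1 - t < 1 by lra.
have := G_conv _ _ _ J_nu J_mu t'01; have := G_conv _ _ _ J_mu J_nu t01.
rewrite opprB addrCA subrr addr0.
have -> : t * mu + m * (1 - t) * nu = nu1 + (mu - nu1) * t by rewrite /nu1; ring.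
have -> : (1 - t) * nu + m * t * mu = nu + (mu1 - nu) * t by rewrite /mu1; ring.
lra.
Qed.
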